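(* Let $\mu$ be a pure $k$-determinantal measure on $[k]^n$ with matrices $A_1,\dots,A_k$, with $\operatorname{rank}(A_i)=n_i$, so $n_1+\dots+n_k=n$. Then $\mu$ can be constructed from elements $L_i\in \mathrm{Gr}_{n_i,n}(\mathbb{R})$, $1\le i\le k$, such that all the products of Plücker coordinates below are nonnegative. That is, there exist real $n_i\times n$ matrices $L_i$ of rank $n_i$ such that the $n\times n$ matrix $L$ obtained by stacking $L_1,\dots,L_k$ from top to bottom is invertible and, with $M=L^{-1}$ and $Q=\det M$: (1) $A_i=M E_i M^{-1}$ for each $i$, where $E_i$ is the diagonal $0/1$ matrix with ones exactly at the diagonal positions in $U_i=\{n_1+\dots+n_{i-1}+1,\dots,n_1+\dots+n_i\}$; (2) for every $\pi\in[k]^n$ in which each color $i$ occurs exactly $n_i$ times, $$\Pr(\pi)=(-1)^\pi\,Q\prod_{i=1}^k L_{U_i}^{\pi(U_i)}\ \ge 0 .$$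
   Context: $[k]=\{1,\dots,k\}$ is the set of colors. A $k$-determinantal measure on $[k]^n$ with matrices $A_1,\dots,A_k$ is a probability measure on $[k]^n$, where the $A_i$ are real $n\times n$ matrices with $A_1+\dots+A_k=I$, and for all $(i_1,\dots,i_n)\in[k]^n$, $\Pr((i_1,\dots,i_n))=\det(A_{i_1}^1,A_{i_2}^2,\dots,A_{i_n}^n)$, the determinant of the matrix whose $j$th column is the $j$th column of $A_{i_j}$. It is pure if the sum of the ranks of the $A_i$ is exactly $n$. $\mathrm{Gr}_{m,n}(\mathbb{R})$ is the space of $m$-planes in $\mathbb{R}^n$, presented as real $m\times n$ matrices of rank $m$ modulo the left action of $\mathrm{GL}_m(\mathbb{R})$; Plücker coordinates are the maximal minors. For a color sequence $\pi$, $\pi(U_i)\subset[n]$ is the set of positions at which the color $i$ occurs in $\pi$. $L_{U_i}^{\pi(U_i)}$ is the determinant of the submatrix of $L$ with rows $U_i$ and columns $\pi(U_i)$ in increasing order (a maximal minor of $L_i$; an empty minor equals $1$). $(-1)^\pi$ is the signature of the permutation of $[n]$ which, for each $i$, maps the $r$th smallest element of $U_i$ to the $r$th smallest element of $\pi(U_i)$. *)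

(* Defs.v *)
From mathcomp Require Import all_boot all_order all_fingroup all_algebra.
From mathcomp Require Export reals.

Set Implicit Arguments.
Unset Strict Implicit.
Unset Printing Implicit Defensive.

Import Order.TTheory GRing.Theory Num.Theory.
Local Open Scope ring_scope.

(* Colors and positions are numbered from 0: [k] is 'I_k, [n] is 'I_n. *)
Definition coloring (k n : nat) := {ffun 'I_n -> 'I_k}.

(* A probability measure on the finite set [k]^n, given by its point masses. *)
Definition probability_mass (R : realType) (k n : nat) (Pr : coloring k n -> R) :=
  (forall pi, 0 <= Pr pi) /\ \sum_pi Pr pi = 1.

Definition determinantal (R : realType) (k n : nat)
    (A : 'I_k -> 'M[R]_n) (Pr : coloring k n -> R) : Prop :=
  [/\ probability_mass Pr,
      \sum_i A i = 1%:M
    & forall pi : coloring k n, Pr pi = \det (\matrix_(r, c) A (pi c) r c)].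

Definition pure (R : realType) (k n : nat) (A : 'I_k -> 'M[R]_n) : Prop :=
  (\sum_i \rank (A i) = n)%N.

Definition positions (k n : nat) (pi : coloring k n) (i : 'I_k) : {set 'I_n} :=
  [set c | pi c == i].

(* The i-th of k consecutive intervals, of lengths n_ 0, n_ 1, ... *)
Definition block (k n : nat) (n_ : 'I_k -> nat) (i : 'I_k) : {set 'I_n} :=
  [set r : 'I_n | (\sum_(j < k | j < i) n_ j <= r < \sum_(j < k | j <= i) n_ j)%N].

(* enum lists a subset of 'I_n in increasing order, so the r-th element of the
   i-th block is sent to the r-th element of positions pi i.  Existence and
   uniqueness are proved in block_permP and block_perm_uniq. *)
Definition block_perm (k n : nat) (n_ : 'I_k -> nat) (pi : coloring k n) :
    {perm 'I_n} :=
  odflt 1%g [pick s : {perm 'I_n} |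
    [forall i, map s (enum (block n n_ i)) == enum (positions pi i)]].

Definition stack (R : realType) (k n : nat) (n_ : 'I_k -> nat)
    (sum_n : (\sum_i n_ i = n)%N) (L : forall i, 'M[R]_(n_ i, n)) : 'M[R]_n :=
  castmx (sum_n, erefl n) (\mxcol_(i < k) L i).

Definition diag_proj (R : realType) (n : nat) (U : {set 'I_n}) : 'M[R]_n :=
  diag_mx (\row_j (j \in U)%:R).

(* enum_val lists a subset of 'I_n in increasing order.  conform_mx only
   identifies 'I_#|T| with 'I_#|S|; the value is a minor when #|S| = #|T|. *)
Definition minor (R : realType) (n : nat) (X : 'M[R]_n) (S T : {set 'I_n}) : R :=
  \det (conform_mx (0 : 'M[R]_#|S|)
    (mxsub (fun a : 'I_#|S| => enum_val a) (fun b : 'I_#|T| => enum_val b) X)).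

Section BlockPerm.
Variables (k n : nat) (n_ : 'I_k -> nat).
Hypothesis sum_n : (\sum_i n_ i = n)%N.

Let row_of i (j : 'I_(n_ i)) : 'I_n := cast_ord sum_n (tagnat.Rank i j).

Let sum_ltS (i : 'I_k) :
  (\sum_(j < k | j <= i) n_ j = \sum_(j < k | j < i) n_ j + n_ i)%N.
Proof.
rewrite (bigD1 i) //= addnC; congr (_ + _)%N; apply: eq_bigl => j.
by rewrite andbC -val_eqE /= [RHS]ltn_neqAle.
Qed.

Lemma block_cover (r : 'I_n) : exists i, r \in block n n_ i.
Proof.
set s := cast_ord (esym sum_n) r; exists (tagnat.sig1 s).
have Er : r = s :> nat by [].
by rewrite inE Er (tagnat.rect s) leq_addr /= sum_ltS ltn_add2l.
Qed.

Let row_ofE i (j : 'I_(n_ i)) :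
  row_of j = (\sum_(j < k | (j < i)%N) n_ j + j)%N :> nat.
Proof. exact: tagnat.RankEsum. Qed.

Lemma block_row i : block n n_ i = [set row_of j | j in 'I_(n_ i)].
Proof.
apply/setP=> r; apply/idP/imsetP => [|[j _ ->]]; rewrite inE sum_ltS.
  case/andP=> h1 h2.
  have h : (r - \sum_(j < k | (j < i)%N) n_ j < n_ i)%N by rewrite ltn_subLR.
  by exists (Ordinal h) => //; apply/ord_inj; rewrite row_ofE subnKC.
by rewrite row_ofE leq_addr ltn_add2l /=.
Qed.

Lemma card_block i : #|block n n_ i| = n_ i.
Proof.
rewrite block_row card_imset ?card_ord // => j j' /cast_ord_inj /eqP.
by rewrite -val_eqE tagnat.eq_Rank eqxx => /eqP/val_inj.
Qed.

Lemma block_perm_uniq (pi : coloring k n) (s t : {perm 'I_n}) :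
  (forall i, map s (enum (block n n_ i)) = enum (positions pi i)) ->
  (forall i, map t (enum (block n n_ i)) = enum (positions pi i)) -> s = t.
Proof.
move=> hs ht; apply/permP=> r; have [i ri] := block_cover r.
have /eq_in_map : map s (enum (block n n_ i)) = map t (enum (block n n_ i)).
  by rewrite hs ht.
by apply; rewrite mem_enum.
Qed.

Lemma block_permP (pi : coloring k n) :
  (forall i, #|positions pi i| = n_ i) ->
  forall i, map (block_perm n_ pi) (enum (block n n_ i)) = enum (positions pi i).
Proof.
move=> hpi; rewrite /block_perm; case: pickP => [s /forallP hs i|no].
  exact/eqP/hs.
pose col r := xchoose (block_cover r).
have colP r : r \in block n n_ (col r) by apply: (xchooseP (block_cover r)).
pose f r := nth r (enum (positions pi (col r))) (index r (enum (block n n_ (col r)))).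
have szE i : size (enum (positions pi i)) = size (enum (block n n_ i)).
  by rewrite -!cardE card_block hpi.
have idx r : (index r (enum (block n n_ (col r))) < size (enum (positions pi (col r))))%N.
  by rewrite szE index_mem mem_enum.
have fpi r : pi (f r) = col r.
  by apply/eqP; have := mem_nth r (idx r); rewrite -/(f r) mem_enum inE.
have finj : injective f.
  move=> r r' e; have ec : col r = col r' by rewrite -!fpi e.
  move: e; rewrite /f -ec => /eqP.
  have idx' := idx r'; rewrite -ec in idx'.
  rewrite (set_nth_default r _ idx') nth_uniq ?enum_uniq ?idx //.
  move/eqP/(congr1 (nth r (enum (block n n_ (col r))))).
  rewrite !nth_index ?mem_enum ?colP //.
  by rewrite ec.
have colE r i : r \in block n n_ i -> col r = i.
  move=> ri; apply/eqP; have := colP r; move: ri; rewrite !block_row.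
  case/imsetP=> j _ -> /imsetP[j' _ /cast_ord_inj /eqP].
  by rewrite -val_eqE tagnat.eq_Rank eq_sym => /andP[].
move: (no (perm finj)) => /negP[]; apply/forallP=> i; apply/eqP.
have sz := szE i.
case E: (enum (block n n_ i)) => [|x0 l].
  by move: sz; rewrite E => /size0nil ->.
rewrite -E; apply: (@eq_from_nth _ x0); first by rewrite size_map.
move=> a; rewrite size_map => ha; rewrite (nth_map x0) // permE /f.
have -> : col (nth x0 (enum (block n n_ i)) a) = i.
  by apply: colE; rewrite -mem_enum mem_nth.
by rewrite index_uniq ?enum_uniq //; apply: set_nth_default; rewrite sz.
Qed.

End BlockPerm.

(* Main.v *)
(** Since the ranks add up to [n], the rank factorizations
    [A_i = C_i L_i] assemble into square matrices with
    [(C_1 ... C_k) L = \sum_i A_i = 1], so [M = L^-1] is the row of the [C_i]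
    and [A_i = M E_i L].  The matrix defining [Pr pi] is then [M B], where [B]
    keeps of each column [c] of [L] only the rows in [U_(pi c)]; permuting the
    columns of [B] by [block_perm] makes it block diagonal. *)

Require Import Defs.
From mathcomp Require Import all_boot all_order all_fingroup all_algebra reals.
Local Open Scope ring_scope.

Set Implicit Arguments.
Unset Strict Implicit.
Unset Printing Implicit Defensive.

Import GRing.Theory.

(** Induction on the number of blocks: splitting off the first one leaves a two-by-two block
    triangular matrix. *)
Lemma det_mxdiag (R : comPzRingType) k (n_ : 'I_k -> nat)
    (B : forall i, 'M[R]_(n_ i)) :
  \det (\mxdiag_i B i) = \prod_i \det (B i).
Proof.
elim: k n_ B => [|k IHk] n_ B.
  (* The matrix is generalized first because its type contains the empty sum to be rewritten to
     0. *)
  by move: (\mxdiag__ _); rewrite !big_ord0 => M; rewrite det_mx00.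
rewrite mxdiag_recl [RHS]big_ord_recl /= -IHk.
by case: _ / mxsize_recl; rewrite castmx_id det_ublock.
Qed.

(** Frees [minor] from its cardinal-indexed types: any increasing enumerations of the rows and
    columns may replace [enum_val]. *)
Lemma minorE (R : realType) n m (X : 'M[R]_n) (S T : {set 'I_n})
    (f g : 'I_m -> 'I_n) :
    enum S = [seq f a | a : 'I_m] -> enum T = [seq g a | a : 'I_m] ->
  minor X S T = \det (mxsub f g X).
Proof.
have aux (V : {set 'I_n}) (h : 'I_m -> 'I_n) : enum V = [seq h a | a : 'I_m] ->
    {eV : #|V| = m & enum_val =1 h \o cast_ord eV}.
  move=> hV; have eV : #|V| = m by rewrite cardE hV size_map -cardE card_ord.
  exists eV => a; rewrite /enum_val hV (nth_map (cast_ord eV a)) /=.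
    by congr h; apply: val_inj; rewrite /= nth_enum_ord // -eV.
  by rewrite -cardE card_ord -eV.
move=> /aux[eS hS] /aux[eT hT].
rewrite /minor (eq_mxsub _ _ hS hT) {hS hT}.
(* Once both cardinals become the variable [m], [conform_mx] is the identity and its default 0 is
   not reached. *)
move: #|S| #|T| eS eT => p q ep eq; subst p q.
rewrite conform_mx_id; congr (\det _); apply: eq_mxsub => a /=;
  by rewrite cast_ord_id.
Qed.

Section Blocks.
Variables (k : nat) (n_ : 'I_k -> nat).
Let n := (\sum_i n_ i)%N.
Import tagnat.

Lemma mem_block i (r : 'I_n) : (r \in block n n_ i) = (sig1 r == i).
Proof.
rewrite (block_row (erefl n)); apply/imsetP/eqP => [[j _ ->]|<-].
  by rewrite cast_ord_id Rank1K.
by exists (sig2 r) => //; rewrite cast_ord_id sig2K.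
Qed.

(** Both lists are strictly increasing and have the same members; [Rank i] is increasing because it
    adds a fixed offset. *)
Lemma enum_block i : enum (block n n_ i) = [seq Rank i j | j : 'I_(n_ i)].
Proof.
pose lt (r s : 'I_n) := (r < s)%N.
have lt_tr : transitive lt by move=> ? ? ?; apply: ltn_trans.
have sorted_ord p : sorted (fun a b : 'I_p => (a < b)%N) (enum 'I_p).
  by have := iota_ltn_sorted 0 p; rewrite -val_enum_ord sorted_map.
apply: (irr_sorted_eq lt_tr) => [r||| r]; first exact: ltnn.
- by rewrite /enum_mem; apply: sorted_filter => //; rewrite -enumT sorted_ord.
- rewrite sorted_map; apply: sub_sorted (sorted_ord _) => a b ab.
  by change (Rank i a < Rank i b)%N; rewrite !RankEsum ltn_add2l.
rewrite mem_enum mem_block; apply/eqP/mapP => [<-|[j _ ->]].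
  by exists (sig2 r); rewrite ?mem_enum ?sig2K.
exact: Rank1K.
Qed.

Lemma block_perm_color (pi : coloring k n) (r : 'I_n) :
  (forall i, #|positions pi i| = n_ i) -> pi (block_perm n_ pi r) = sig1 r.
Proof.
move=> /(block_permP (erefl n))/(_ (sig1 r)) e; apply/eqP.
have : block_perm n_ pi r \in enum (positions pi (sig1 r)).
  by rewrite -e map_f // mem_enum mem_block.
by rewrite mem_enum inE.
Qed.

Variable R : realType.

Lemma diag_proj_mxcol i (L : forall j, 'M[R]_(n_ j, n)) :
  diag_proj R (block n n_ i) *m \mxcol_j L j =
  \mxcol_j (if j == i then L j else 0).
Proof.
apply/matrixP=> r c; rewrite mul_diag_mx !mxE mem_block.
by case: eqP => _; rewrite ?mul1r // mul0r mxE.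
Qed.

Lemma det_select_rows (L : 'M[R]_n) (pi : coloring k n) :
    (forall i, #|positions pi i| = n_ i) ->
  \det (\matrix_(r, c) ((sig1 r == pi c)%:R * L r c)) =
  (-1) ^+ block_perm n_ pi
    * \prod_i minor L (block n n_ i) (positions pi i).
Proof.
move=> cardpi; set B := \matrix_(_, _) _; set s := block_perm n_ pi.
have sB : col_perm s B = \mxdiag_i mxsub (Rank i) (s \o Rank i) L.
  apply/matrixP=> r c; rewrite !mxE block_perm_color //.
  case: eqP => [|_]; last by rewrite mul0r mxE.
  (* Writing [r] and [c] as pairs (block, offset) lets the equality of their blocks be substituted
     in the dependent types. *)
  rewrite mul1r -{2}[r]sig2K -{2}[c]sig2K.
  move: (sig1 r) (sig2 r) (sig1 c) (sig2 c) => i a j b ij; subst j.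
  by rewrite conform_mx_id mxE.
have -> : \det B = (-1) ^+ s * \det (col_perm s B).
  rewrite col_permE det_mulmx det_perm odd_permV mulrC -mulrA.
  by rewrite -signr_addb addbb mulr1.
rewrite sB det_mxdiag; congr (_ * _); apply: eq_bigr => i _.
(* By [block_permP], [s] lists the positions of color [i] in increasing order along block [i], so no
   further sign arises. *)
rewrite (minorE _ (enum_block i) (g := s \o Rank i)) //.
by rewrite -(block_permP (erefl n)) // enum_block -map_comp.
Qed.

End Blocks.

Lemma stack_factorization (R : realType) k n (n_ : 'I_k -> nat)
    (sum_n : (\sum_i n_ i = n)%N) (C : forall i, 'M[R]_(n, n_ i))
    (L_ : forall i, 'M[R]_(n_ i, n)) (L := stack sum_n L_) :
    \sum_i C i *m L_ i = 1%:M ->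
  L \in unitmx /\
  forall i, C i *m L_ i = invmx L *m diag_proj R (block n n_ i) *m L.
Proof.
(* Replacing [n] by the sum itself makes the cast in [stack] trivial. *)
rewrite {}/L; case: _ / sum_n C L_ => C L_; rewrite /stack castmx_id => CL1.
have CL : \mxrow_i C i *m \mxcol_i L_ i = 1%:M by rewrite mul_mxrow_mxcol.
(* Both factors are square, so a one-sided inverse is two-sided. *)
have [_ uL] := mulmx1_unit CL; split=> // i.
have -> : invmx (\mxcol_i L_ i) = \mxrow_i C i.
  by rewrite -[LHS]mul1mx -CL mulmxK.
rewrite -mulmxA diag_proj_mxcol mul_mxrow_mxcol [RHS](bigD1 i) //= eqxx.
by rewrite [X in _ + X]big1 ?addr0 // => j /negPf->; rewrite mulmx0.
Qed.

Lemma det_color_columns (R : realType) k n (n_ : 'I_k -> nat)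
    (M L : 'M[R]_n) (pi : coloring k n) :
    (\sum_i n_ i = n)%N -> (forall i, #|positions pi i| = n_ i) ->
  \det (\matrix_(r, c) (M *m diag_proj R (block n n_ (pi c)) *m L) r c) =
  (-1) ^+ block_perm n_ pi * \det M
    * \prod_i minor L (block n n_ i) (positions pi i).
Proof.
move=> sum_n; case: _ / sum_n M L pi => M L pi cardpi.
rewrite [_ * \det M]mulrC -mulrA -det_select_rows // -det_mulmx.
(* The projection depends on the column [c], but the left factor [M] does not, so it comes out of
   the whole matrix. *)
congr (\det _); apply/matrixP=> r c; rewrite mxE -mulmxA !mxE.
by apply: eq_bigr => r' _; rewrite mul_diag_mx !mxE mem_block.
Qed.

Theorem corollary8 (R : realType) (k n : nat)
    (A : 'I_k -> 'M[R]_n) (Pr : coloring k n -> R)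
    (hdet : determinantal A Pr) (hpure : pure A) :
  let n_ := fun i => \rank (A i) in
  let U := block n n_ in
  exists L_ : forall i, 'M[R]_(n_ i, n),
    (forall i, \rank (L_ i) = n_ i) /\
    let L := stack hpure L_ in
    let M := invmx L in
    let Q := \det M in
    [/\ L \in unitmx,
        forall i, A i = M *m diag_proj R (U i) *m invmx M
      & forall pi : coloring k n,
          (forall i, #|positions pi i| = n_ i) ->
          Pr pi = (-1) ^+ (block_perm n_ pi)
                    * Q * \prod_(i < k) minor L (U i) (positions pi i)
          /\ 0 <= (-1) ^+ (block_perm n_ pi)
                    * Q * \prod_(i < k) minor L (U i) (positions pi i)].
Proof.
move=> n_ U; have [[Pr_ge0 _] sumA PrE] := hdet.
(* The witness is the right factor of the rank factorization of [A i] into [col_base] and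
   [row_base]. *)
exists (fun i => row_base (A i)); split=> [i|L M Q].
  by apply/eqP; exact: row_base_free.
have /(stack_factorization hpure)[uL AE] :
    \sum_i col_base (A i) *m row_base (A i) = 1%:M.
  by rewrite -sumA; apply: eq_bigr => i _; rewrite mulmx_base.
have {}AE i : A i = M *m diag_proj R (U i) *m L by rewrite -AE mulmx_base.
split=> // [i|pi cardpi]; first by rewrite invmxK.
(* Nonnegativity is inherited: the signed product is a probability. *)
have <- : Pr pi = (-1) ^+ block_perm n_ pi * Q
    * \prod_(i < k) minor L (U i) (positions pi i).
  rewrite PrE -det_color_columns //; congr (\det _).
  by apply/matrixP=> r c; rewrite !mxE {1}AE mxE.
by split.
Qed.
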